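(* Let $\mathrm P$ be a loopless polymatroid on $E$ of type $\mathbf a$ and rank $r$, and let $S_1,\dots,S_{r-1}$ be nonempty subsets of $E$. Say that they satisfy the dragon Hall–Rado condition if $\operatorname{rk}_{\mathrm P}(\bigcup_{j\in J}S_j)\ge|J|+1$ for all nonempty $J\subseteq\{1,\dots,r-1\}$. Then $$\deg_{X_{\mathbf a}}\big(h_{S_1}\cdots h_{S_{r-1}}\cdot[\Sigma_{\mathrm P}]\cdot[\underline X_{\mathbf a}]\big)=\begin{cases}1&\text{if the dragon Hall--Rado condition is satisfied},\\0&\text{otherwise.}\end{cases}$$
   Context: $E=\{1,\dots,m\}$, $\mathbf a\in\mathbb Z^m_{\ge0}$, $n=\sum a_i$. Polymatroid of type $\mathbf a$: submodular monotone $\operatorname{rk}_{\mathrm P}:2^E\to\mathbb Z_{\ge0}$, $\operatorname{rk}_{\mathrm P}(\emptyset)=0$, $\operatorname{rk}_{\mathrm P}(\{i\})\le a_i$; loopless means $\operatorname{rk}_{\mathrm P}(\{i\})>0$ for all $i$; flats $F$: $\operatorname{rk}(F\cup e)>\operatorname{rk}(F)$ for $e\notin F$. $\widetilde E$ an $n$-element set, $\pi:\widetilde E\to E$ with $|\pi^{-1}(i)|=a_i$, $\mathbf e_U=\sum_{j\in U}\mathbf e_j$. Polystellahedral fan $\Sigma_{\mathbf a}\subset\mathbb R^{\widetilde E}$: cones $\sigma_{I\le\mathcal F}=\operatorname{cone}(-\mathbf e_{\widetilde E\setminus\pi^{-1}(F_1)},\dots,-\mathbf e_{\widetilde E\setminus\pi^{-1}(F_k)},\mathbf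 e_j:j\in I)$ for $I\subseteq\widetilde E$ and chains $F_1\subsetneq\dots\subsetneq F_{k+1}=E$ ($k\ge0$) with $\pi^{-1}(A)\subseteq I\Rightarrow A\subseteq F_1$; $X_{\mathbf a}$ its smooth projective toric variety, $\deg_{X_{\mathbf a}}:A^n(X_{\mathbf a})\to\mathbb Z$. $x_S$ ($\emptyset\subseteq S\subsetneq E$) is the divisor class of ray $\rho_S=\mathbb R_{\ge0}(-\mathbf e_{\widetilde E\setminus\pi^{-1}(S)})$; $h_S=\sum_{T\subsetneq E,\,T\not\supseteq S}x_T$ for nonempty $S$. $\underline X_{\mathbf a}$ is the torus-invariant divisor of $\rho_\emptyset$, so $[\underline X_{\mathbf a}]=x_\emptyset$. Augmented Bergman fan $\Sigma_{\mathrm P}$: cones $\sigma_{S\le\mathcal F}$ with $F_1,\dots,F_k$ proper flats of $\mathrm P$, $\operatorname{rk}_{\mathrm P}(\pi(T))\ge|T|$ for $T\subseteq S$, and $\operatorname{rk}_{\mathrm P}(F\cup\pi(T))>\operatorname{rk}_{\mathrm P}(F)+|T|$ for $F\in\mathcal F$, nonempty $T\subseteq S\setminus\pi^{-1}(F)$; $[\Sigma_{\mathrm P}]\in A^{n-r}(X_{\mathbf a})$ is the class with $\deg([\Sigma_{\mathrm P}][Z_\sigma])=1$ if $\sigma\in\Sigma_{\mathrm P}$, $0$ otherwise, for $r$-dimensional $\sigma\in\Sigma_{\mathbf a}$ ($Z_\sigma$ orbit closure). *)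

(* Defs.v *)
From HB Require Import structures.
From mathcomp Require Import all_boot all_order all_algebra.
From mathcomp Require Import mpoly.
Set Implicit Arguments. Unset Strict Implicit. Unset Printing Implicit Defensive.
Import GRing.Theory.
Local Open Scope ring_scope.

Definition polymatroid (m : nat) (a : 'I_m -> nat) (rk : {set 'I_m} -> nat) : Prop :=
  [/\ rk set0 = 0%N,
      (forall A B : {set 'I_m}, A \subset B -> (rk A <= rk B)%N),
      (forall A B : {set 'I_m}, (rk (A :|: B) + rk (A :&: B) <= rk A + rk B)%N) &
      (forall i, (rk [set i] <= a i)%N)].

Definition loopless (m : nat) (rk : {set 'I_m} -> nat) : Prop :=
  forall i : 'I_m, (0 < rk [set i])%N.

Definition is_flat (m : nat) (rk : {set 'I_m} -> nat) (F : {set 'I_m}) : bool :=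
  [forall e, (e \notin F) ==> (rk F < rk (e |: F))%N].

Definition Etil (m : nat) (a : 'I_m -> nat) : finType := {i : 'I_m & 'I_(a i)}.
Definition pi_ {m} {a : 'I_m -> nat} (j : Etil a) : 'I_m := tag j.
Definition preim {m} {a : 'I_m -> nat} (A : {set 'I_m}) : {set Etil a} :=
  [set j | pi_ j \in A].
Definition pimg {m} {a : 'I_m -> nat} (T : {set Etil a}) : {set 'I_m} :=
  [set pi_ j | j in T].

(* Rays of the polystellahedral fan: e_j (j in Etil) and rho_S (S proper). *)
Definition properset (m : nat) : finType := {S : {set 'I_m} | S != setT}.
Definition Ray (m : nat) (a : 'I_m -> nat) : finType := (Etil a + properset m)%type.

Definition rayvec {m} {a : 'I_m -> nat} (rho : Ray a) (j : Etil a) : int :=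
  match rho with
  | inl j' => (j == j')%:Z
  | inr S0 => - ((j \notin preim (val S0)) : nat)%:Z
  end.

(* A set C of rays spans a cone sigma_{I <= F} of Sigma_a. *)
Definition is_cone {m} {a : 'I_m -> nat} (C : {set Ray a}) : bool :=
  let I := [set j | inl j \in C] in
  let Fs := [set val S | S in [set S | inr S \in C]] in
  [forall S in Fs, forall T in Fs, (S \subset T) || (T \subset S)] &&
  [forall A : {set 'I_m}, (preim A \subset I) ==> [forall F in Fs, A \subset F]].

(* Cones of the augmented Bergman fan Sigma_P (within Sigma_a). *)
Definition in_bergman {m} {a : 'I_m -> nat} (rk : {set 'I_m} -> nat)
    (C : {set Ray a}) : bool :=
  let I := [set j | inl j \in C] in
  let Fs := [set val S | S in [set S | inr S \in C]] in
  [&& is_cone C,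
      [forall F in Fs, is_flat rk F],
      [forall T : {set Etil a}, (T \subset I) ==> (#|T| <= rk (pimg T))%N] &
      [forall F in Fs, forall T : {set Etil a},
          ((T != set0) && (T \subset I :\: preim F)) ==>
          (rk F + #|T| < rk (F :|: pimg T))%N]].

(* Polynomial ring Z[x_rho : rho ray]; the Chow ring A^*(X_a) is its quotient
   by the Stanley-Reisner ideal and the linear relations. *)
Definition cpoly (m : nat) (a : 'I_m -> nat) := {mpoly int[#|Ray a|]}.
Definition xray {m} {a : 'I_m -> nat} (rho : Ray a) : cpoly a := 'X_(enum_rank rho).
Definition xmono {m} {a : 'I_m -> nat} (C : {set Ray a}) : cpoly a :=
  \prod_(rho in C) xray rho.
(* x_S for S a proper subset of E (= 0 if S = E, which never occurs below). *)
Definition xS {m} (a : 'I_m -> nat) (S : {set 'I_m}) : cpoly a :=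
  \sum_(rho : Ray a | if rho is inr T0 then val T0 == S else false) xray rho.
Definition hS {m} (a : 'I_m -> nat) (S : {set 'I_m}) : cpoly a :=
  \sum_(T : {set 'I_m} | (T != setT) && ~~ (S \subset T)) xS a T.
(* linear relation attached to the coordinate function e_j^* *)
Definition linrel {m} {a : 'I_m -> nat} (j : Etil a) : cpoly a :=
  \sum_(rho : Ray a) rayvec rho j *: xray rho.

Definition homog_of {m} {a : 'I_m -> nat} (d : nat) (p : cpoly a) : bool :=
  all (fun mm => mdeg mm == d) (msupp p).

(* phi is the degree map deg_{X_a} composed with the quotient map
   Z[x] -> A^*(X_a) and the projection onto A^n(X_a), n = |Etil|. *)
Definition chow_degree {m} {a : 'I_m -> nat} (phi : cpoly a -> int) : Prop :=
  [/\ (forall p q, phi (p + q) = phi p + phi q),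
      (forall mm : 'X_{1.. #|Ray a|}, mdeg mm != #|Etil a| -> phi 'X_[mm] = 0),
      (forall (C : {set Ray a}) q, ~~ is_cone C -> phi (q * xmono C) = 0),
      (forall (j : Etil a) q, phi (q * linrel j) = 0) &
      (forall C : {set Ray a}, is_cone C -> #|C| = #|Etil a| -> phi (xmono C) = 1)].

(* p represents the class [Sigma_P] in A^{n-r}(X_a) (r = rk E), w.r.t. phi:
   deg([Sigma_P][Z_sigma]) = 1 if sigma in Sigma_P, 0 otherwise, for every
   r-dimensional cone sigma of Sigma_a ([Z_sigma] = product of its rays). *)
Definition bergman_class {m} {a : 'I_m -> nat} (rk : {set 'I_m} -> nat)
    (phi : cpoly a -> int) (p : cpoly a) : Prop :=
  homog_of (#|Etil a| - rk setT) p /\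
  forall C : {set Ray a}, is_cone C -> #|C| = rk setT ->
    phi (p * xmono C) = (in_bergman rk C : nat)%:Z.

Definition dragon_hall_rado {m} (rk : {set 'I_m} -> nat) (k : nat)
    (S : 'I_k -> {set 'I_m}) : bool :=
  [forall J : {set 'I_k}, (J != set0) ==> (#|J| + 1 <= rk (\bigcup_(j in J) S j))%N].

(* Main.v *)
(** Let [rho_0] be the ray of the empty set and [C] a cone containing it, with point
    set [I] and flags [Fs].  Put [f G = rk G - |I ∩ pi^-1 G|], a submodular function.
    Membership of [C] in the augmented Bergman fan then collapses to one condition:
    [Fs] is a chain and [f F < f G] whenever [F ∈ Fs] and [F ⊊ G].

    Multiplying by [h_S] is principal truncation.  Let [F] be the largest flag of [C] not
    containing [S], and choose [i ∈ S \ F] and a point [j ∉ I] over [i].  Modulo the linear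
    relation of [j], [h_S = x_j + Σ x_T] over the proper [T] with [i ∈ T] and [S ⊄ T], and
    none of these rays lies in [C]; so only squarefree monomials occur.  Let [C] lie in the
    fan with codimension one, and call [T ∋ i] tight if [F ⊆ T] and [f T = f F + 1].  Tight
    sets are closed under union.  The term of [x_j] counts 1 if there is no tight set, and
    otherwise the only [T] that can be inserted into [C] is the largest tight set, provided
    it does not contain [S].  So the total is 1 if [f G >= f F + 2] for all [G ⊇ F ∪ S] and
    0 otherwise, which says exactly that [C] lies in the fan of the principal truncation
    [min (rk A, rk (A ∪ S) - 1)].  Truncating along all [S_j] leaves a polymatroid of rank one,
    unless a loop appears, which happens exactly when the dragon condition fails. *)
Require Import Defs.
From HB Require Import structures.
From mathcomp Require Import all_boot all_order all_algebra.
From mathcomp Require Import mpoly.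
From mathcomp Require Import zify.
Set Implicit Arguments. Unset Strict Implicit. Unset Printing Implicit Defensive.
Import Order.TTheory GRing.Theory Num.Theory.
Local Open Scope ring_scope.

(** * Chains of sets along which a submodular function rises *)

Section Flags.
Variable V : finType.
Implicit Types (f : {set V} -> int) (Fs : {set {set V}}) (F G T X : {set V}).

Definition is_chain Fs := [forall F in Fs, forall G in Fs, (F \subset G) || (G \subset F)].

Definition submodular f := forall A B, f (A :|: B) + f (A :&: B) <= f A + f B.

Definition rises f Fs := [forall F in Fs, forall G : {set V}, (F \proper G) ==> (f F < f G)].

Definition far f F X := [forall G : {set V}, (F \subset G) && (X \subset G) ==> (f F + 2 <= f G)].

(** Adding a point over [i] to a cone and truncating along [S] both amount to this condition, for
    [X = {i}] and [X = S]. *)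
Definition gaps f Fs X := [forall F in Fs, (X \subset F) || far f F X].

Lemma chainP Fs F G : is_chain Fs -> F \in Fs -> G \in Fs -> (F \subset G) || (G \subset F).
Proof. by move=> /forall_inP h /h/forall_inP; apply. Qed.

Lemma risesP f Fs : reflect (forall F G, F \in Fs -> F \proper G -> f F < f G) (rises f Fs).
Proof.
apply: (iffP forall_inP) => [h F G /h/forallP/(_ G)/implyP|h F FFs]; first exact.
by apply/forallP => G; apply/implyP; apply: h.
Qed.

Lemma farP f F X :
  reflect (forall G, F \subset G -> X \subset G -> f F + 2 <= f G) (far f F X).
Proof.
apply: (iffP forallP) => [h G FG XG|h G]; first by move/implyP: (h G); rewrite FG XG; apply.
by apply/implyP => /andP[]; apply: h.
Qed.

Lemma rises_le f Fs F G : rises f Fs -> F \in Fs -> F \subset G -> f F <= f G.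
Proof.
move=> /risesP rf FFs; rewrite subEproper => /predU1P[->//|FG].
by rewrite ltW// rf.
Qed.

(** Each counted set accounts for a rise of at least one; [F] is counted and [G] is not. Induction
    passes from [G] to the largest counted set. *)
Lemma chain_height f Fs F G : is_chain Fs -> rises f Fs -> F \in Fs -> F \subset G ->
  f F + #|[set H in Fs | (F \subset H) && (H \proper G)]|%:Z <= f G.
Proof.
move=> cFs rf FFs; have [n] := ubnP #|G|; elim: n G => // n IHn G ltGn FG.
set D := [set _ in _ | _]; have [->|[H0 H0D]] := set_0Vmem D.
  by rewrite cards0 addr0 (rises_le rf).
case: (@arg_maxnP _ H0 (mem D) (fun H : {set V} => #|H|) H0D) => M MD Mmax.
have := MD; rewrite !inE => /and3P[MFs FM MG].
have ltMn : (#|M| < n)%N by have := proper_card MG; move: ltGn; clear; lia.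
have := IHn M ltMn FM; set D' := [set _ in _ | _] => hM.
have -> : D = M |: D'.
  apply/setP => H; rewrite !inE; apply/idP/idP => [HD|].
    have [-> //|/= HM] := eqVneq H M; case/and3P: HD => HFs FH HG.
    rewrite HFs FH properEneq HM /=.
    case/orP: (chainP cFs HFs MFs) => // MH.
    have : H \in D by rewrite !inE HFs FH HG.
    move=> /Mmax HM'; suff : M = H by move=> e; rewrite e eqxx in HM.
    by apply/eqP; rewrite eqEcard MH.
  case/predU1P => [->|/and3P[-> -> HM]]; first by rewrite MFs FM.
  exact: proper_trans HM MG.
have MD' : M \notin D' by rewrite !inE properxx !andbF.
rewrite cardsU1 MD'; have /risesP/(_ _ _ MFs MG) := rf; move: hM; clear; lia.
Qed.

(** Only the largest member [F] not containing [X] matters: for [F'] inside [F], submodularity on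
    [F] and [G] transports the gap, because [f F' <= f (F :&: G)]. *)
Lemma gaps_far f Fs F X : submodular f -> is_chain Fs -> rises f Fs -> F \in Fs ->
  ~~ (X \subset F) -> (forall G, G \in Fs -> F \proper G -> X \subset G) ->
  gaps f Fs X = far f F X.
Proof.
move=> sub_f cFs rf FFs XF Fmax; apply/idP/farP => [/forall_inP/(_ F FFs)|hF].
  by rewrite (negPf XF) => /farP.
apply/forall_inP => F' F'Fs; have [//|/= XF'] := boolP (X \subset F').
have F'F : F' \subset F.
  case/orP: (chainP cFs F'Fs FFs) => //; rewrite subEproper => /predU1P[->//|FF'].
  by rewrite (Fmax _ F'Fs FF') in XF'.
apply/farP => G F'G XG.
have := sub_f F G; have := hF (F :|: G) (subsetUl _ _) (subset_trans XG (subsetUr _ _)).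
have := @rises_le _ _ F' (F :&: G) rf F'Fs; rewrite subsetI F'F F'G => /(_ isT); clear; lia.
Qed.

(** * Tight sets and the insertion of one set into a chain *)

(* By [chain_height], [dimFs] says that [Fs] is one member short of the maximal length. *)
Section Refine.
Variables (f : {set V} -> int) (Fs : {set {set V}}) (F X : {set V}) (i : V).
Hypotheses (sub_f : submodular f) (cFs : is_chain Fs) (rf : rises f Fs) (FFs : F \in Fs).
Hypothesis Fmax : forall G, G \in Fs -> F \proper G -> X \subset G.
Hypotheses (iX : i \in X) (iF : i \notin F).
Hypotheses (Fs0 : set0 \in Fs) (FsT : setT \notin Fs) (dimFs : f setT = f set0 + #|Fs|.+1%:Z).

Let insertable T := [&& i \in T, ~~ (X \subset T), is_chain (T |: Fs) & rises f (T |: Fs)].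
Let tight G := [&& F \subset G, i \in G & f G == f F + 1].

Let FpG G : F \subset G -> i \in G -> F \proper G.
Proof. by move=> FG iG; apply/properP; split=> //; exists i. Qed.

Let not_far G : F \subset G -> i \in G -> ~~ tight G -> f F + 2 <= f G.
Proof.
move=> FG iG; rewrite /tight FG iG /=; have /risesP/(_ _ _ FFs (FpG FG iG)) := rf; clear; lia.
Qed.

(** Union and intersection both strictly contain [F], so each has value at least [f F + 1];
    submodularity leaves no room for more. *)
Let tightU G H : tight G -> tight H -> tight (G :|: H).
Proof.
move=> /and3P[FG iG /eqP eG] /and3P[FH iH /eqP eH].
have FGH : F \subset G :&: H by rewrite subsetI FG.
have iGH : i \in G :&: H by rewrite inE iG.
have FGUH : F \subset G :|: H by apply: subset_trans FG (subsetUl _ _).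
have iGUH : i \in G :|: H by rewrite inE iG.
rewrite /tight FGUH iGUH /=.
have /risesP r := rf; have := r _ _ FFs (FpG FGH iGH); have := r _ _ FFs (FpG FGUH iGUH).
have := sub_f G H; move: eG eH; clear; lia.
Qed.

(** The flags below [F] bound [f F] from below, those from [T] upwards bound [f T] from above; by
    [dimFs] this leaves [f T <= f F + 1]. *)
Let insertable_tight T : insertable T -> tight T.
Proof.
move=> /and4P[iT XT cT rT].
have TFs : T \in T |: Fs by rewrite setU11.
have sFs G : G \in Fs -> G \in T |: Fs by move=> h; rewrite inE h orbT.
have FT : F \subset T.
  by case/orP: (chainP cT TFs (sFs _ FFs)) => // /subsetP/(_ i iT); rewrite (negPf iF).
have nT : T \notin Fs.
  by apply/negP => /Fmax/(_ (FpG FT iT)); rewrite (negPf XT).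
rewrite /tight FT iT /=.
have h1 := chain_height cFs rf Fs0 (sub0set F).
have h2 := chain_height cT rT TFs (subsetT T).
have /risesP/(_ _ _ FFs (FpG FT iT)) h3 := rf.
set B := [set _ in _ | _] in h1; set A := [set _ in _ | _] in h2.
(* Each set of [T |: Fs] lies strictly below [F], equals [F], or contains [T]: a flag strictly above
   [F] contains [X], hence cannot lie inside [T]. *)
have : (#|Fs|.+1 <= #|B| + 1 + #|A|)%N.
  have <- : #|T |: Fs| = #|Fs|.+1 by rewrite cardsU1 nT.
  rewrite -(cards1 F).
  apply: leq_trans (leq_trans (leq_card_setU _ _) (leq_add (leq_card_setU _ _) (leqnn _))).
  apply: subset_leq_card; apply/subsetP => H HT; rewrite !inE in HT *.
  rewrite sub0set /= properT.
  have [HT'|HT'] /= := boolP (T \subset H).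
    rewrite HT /=; have [HE|_] := eqVneq H setT; last by rewrite orbT.
    case/predU1P: HT => [HT|]; last by rewrite HE (negPf FsT).
    by move: XT; rewrite -HT HE subsetT.
  case/predU1P: HT => [HT|HFs]; first by rewrite HT subxx in HT'.
  rewrite HFs /=; have [_|HF] := eqVneq H F; rewrite /= ?orbT ?orbF //.
  case/orP: (chainP cFs HFs FFs) => [HF'|FH]; first by rewrite properEneq HF.
  have XH : X \subset H by apply: Fmax => //; rewrite properEneq eq_sym HF.
  case/orP: (chainP cT TFs (sFs _ HFs)) => [TH|HT]; first by rewrite TH in HT'.
  by rewrite (subset_trans XH HT) in XT.
have := dimFs; move: #|A| #|B| h1 h2 h3 => x y; clear; lia.
Qed.

Let maximal_tight M : tight M -> (forall G, tight G -> G \subset M) ->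
  ~~ (X \subset M) -> insertable M.
Proof.
move=> tM Mmax XM; have := tM => /and3P[FM iM /eqP eM].
rewrite /insertable iM XM /=.
(* For a flag [H] strictly above [F], [f (M :&: H) >= f M]; were [M] not inside [H],
   [f (M :|: H) > f H] would contradict submodularity. *)
have cmp H : H \in Fs -> (M \subset H) || (H \subset M).
  move=> HFs; case/orP: (chainP cFs HFs FFs) => [HF|FH].
    by rewrite (subset_trans HF FM) orbT.
  have [<-|nFH] := eqVneq F H; first by rewrite FM orbT.
  have iH : i \in H by apply: (subsetP (Fmax HFs _)) => //; rewrite properEneq nFH.
  have FMH : F \subset M :&: H by rewrite subsetI FM.
  have iMH : i \in M :&: H by rewrite inE iM.
  have [/setUidPl|HM] := boolP (M \subset H); first by [].
  have /risesP r := rf; have := r _ _ FFs (FpG FMH iMH).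
  have := r _ _ HFs (properUr HM); have := sub_f M H; move: eM; clear; lia.
apply/andP; split.
  apply/forall_inP => A; rewrite !inE => AFs; apply/forall_inP => B; rewrite !inE => BFs.
  case/predU1P: AFs => [->|AFs]; case/predU1P: BFs => [->|BFs].
  - by rewrite subxx.
  - exact: cmp.
  - by rewrite orbC cmp.
  - exact: chainP cFs AFs BFs.
apply/risesP => A G; rewrite !inE => /predU1P[-> MG|]; last by move/risesP: rf; apply.
have := @not_far G (subset_trans FM (proper_sub MG)) (subsetP (proper_sub MG) _ iM).
suff -> : ~~ tight G by move=> /(_ isT); move: eM; clear; lia.
by apply/negP => /Mmax GM; rewrite properE GM andbF in MG.
Qed.

(** With no tight set the equation reads 1 = 1 + 0. Otherwise, for the largest tight set [M], it
    reads 0 = 0 + 0 if [X] lies in [M], and 1 = 0 + 1 if not. *)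
Lemma far_refine : (far f F X : nat) = (far f F [set i] + #|[set T | insertable T]|)%N.
Proof.
have [/existsP[G0 tG0]|/existsPn notight] := boolP [exists G, tight G]; last first.
  have hi : far f F [set i].
    by apply/farP => G FG; rewrite sub1set => iG; apply: not_far.
  have hX : far f F X.
    by apply/farP => G FG XG; apply: not_far => //; apply: (subsetP XG).
  rewrite hi hX (_ : [set T | insertable T] = set0) ?cards0//.
  by apply/setP => T; rewrite !inE; apply/negbTE/negP => /insertable_tight; apply/negP.
have [M /maxsetP[tM Mmax] _] := maxset_exists tG0.
have Mtop G : tight G -> G \subset M.
  by move=> tG; rewrite -(Mmax _ (tightU tM tG) (subsetUl _ _)) subsetUr.
have := tM => /and3P[FM iM /eqP eM].
have -> : far f F [set i] = false.
  by apply/negbTE/negP => /farP/(_ M FM); rewrite sub1set => /(_ iM); move: eM; clear; lia.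
have insM T : insertable T -> T = M.
  move=> iT; have tT := insertable_tight iT; case/and4P: iT => _ _ _ /risesP rT.
  have := Mtop _ tT; rewrite subEproper => /predU1P[//|TM].
  have := rT T M (setU11 _ _) TM; case/and3P: tT => _ _; move: eM; clear; lia.
have [XM|XM] := boolP (X \subset M).
  have -> : far f F X = false by apply/negbTE/negP => /farP/(_ M FM XM); move: eM; clear; lia.
  rewrite (_ : [set T | insertable T] = set0) ?cards0//.
  apply/setP => T; rewrite !inE; apply/negbTE/negP => iT.
  by case/and4P: (iT) => _; rewrite (insM _ iT) XM.
have -> : far f F X.
  apply/farP => G FG XG; apply: not_far => //; first exact: (subsetP XG).
  by apply/negP => /Mtop GM; rewrite (subset_trans XG GM) in XM.
rewrite (_ : [set T | insertable T] = [set M]) ?cards1//.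
apply/setP => T; rewrite !inE; apply/idP/eqP => [/insM//|->].
exact: maximal_tight.
Qed.

End Refine.
End Flags.

(** * Membership in the augmented Bergman fan, and principal truncation *)

Section Bergman.
Variables (m : nat) (a : 'I_m -> nat).
Implicit Types (rk : {set 'I_m} -> nat) (A B F G S X : {set 'I_m}) (I T : {set Etil a}).
Implicit Types (C : {set Ray a}) (Fs : {set {set 'I_m}}).

Definition points C : {set Etil a} := [set j | inl j \in C].
Definition flags C : {set {set 'I_m}} := [set val S | S in [set S | inr S \in C]].

Definition load I G : nat := #|I :&: Defs.preim G|.

Definition excess rk I G : int := (rk G)%:Z - (load I G)%:Z.

(** For monotone [rk] with [0 < rk S], this is [rk A] lowered by one exactly when
    [rk (A :|: S) = rk A]. *)
Definition truncation rk S A : nat := minn (rk A) (rk (A :|: S)).-1.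

Lemma loadS I F G : F \subset G -> (load I F <= load I G)%N.
Proof.
move=> FG; apply/subset_leq_card/setIS/subsetP => j; rewrite !inE.
exact: (subsetP FG).
Qed.

Lemma load0 I : load I set0 = 0%N.
Proof.
by rewrite /load (_ : _ :&: _ = set0) ?cards0//; apply/setP => j; rewrite !inE andbF.
Qed.

Lemma loadT I : load I setT = #|I|.
Proof. by rewrite /load (_ : _ :&: _ = I)//; apply/setP => j; rewrite !inE andbT. Qed.

Lemma load_split I F G : F \subset G -> load I G = (load I F + load I (G :\: F))%N.
Proof.
move=> FG; rewrite /load -(cardsID (Defs.preim F)); congr (_ + _)%N; congr #|pred_of_set _|.
  apply/setP => j; rewrite !inE -andbA; congr (_ && _).
  by have := subsetP FG (pi_ j); case: (pi_ j \in F) => [->|]; rewrite ?andbF.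
by apply/setP => j; rewrite !inE; case: (pi_ j \in F); rewrite /= ?andbF.
Qed.

Lemma load_modular I A B : (load I (A :|: B) + load I (A :&: B) = load I A + load I B)%N.
Proof.
rewrite /load -[RHS]cardsUI; congr (_ + _)%N; congr #|pred_of_set _|.
  by apply/setP => j; rewrite !inE andb_orr.
by apply/setP => j; rewrite !inE; case: (j \in I).
Qed.

Lemma load_setU1 I j G : j \notin I -> load (j |: I) G = ((pi_ j \in G) + load I G)%N.
Proof.
move=> jI; rewrite /load; have [jG|jG] := boolP (pi_ j \in G).
  rewrite (_ : (j |: I) :&: _ = j |: (I :&: Defs.preim G)); last first.
    apply/setP => j'; rewrite !inE andb_orl; congr (_ || _).
    by case: eqVneq => // ->; rewrite jG.
  by rewrite cardsU1 !inE (negPf jI).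
congr #|pred_of_set _|.
by apply/setP => j'; rewrite !inE; case: eqVneq => // ->; rewrite (negPf jG) !andbF.
Qed.

Lemma excess_lt rk I F G : F \subset G ->
  (excess rk I F < excess rk I G) = (rk F + load I (G :\: F) < rk G)%N.
Proof.
move=> FG; rewrite /excess (load_split I FG); clear; lia.
Qed.

Lemma excess_submodular rk I : polymatroid a rk -> submodular (excess rk I).
Proof.
case=> _ _ sub _ A B; rewrite /excess; have := load_modular I A B; have := sub A B; clear; lia.
Qed.

Lemma card_preim1 i : #|Defs.preim [set i] : {set Etil a}| = a i.
Proof.
have tag_inj : injective (fun k : 'I_(a i) => Tagged (fun i => 'I_(a i)) k : Etil a).
  by move=> k l /eqP; rewrite eq_Tagged => /eqP.
rewrite -[RHS]card_ord -cardsT -(card_imset _ tag_inj).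
apply: eq_card => -[i' k]; rewrite !inE /pi_ /=.
apply/eqP/imsetP => [e|[k' _ /(congr1 tag)]//].
by subst i'; exists k.
Qed.

Lemma rk_setU1 rk F i : polymatroid a rk -> (rk (i |: F) <= rk F + a i)%N.
Proof.
case=> _ _ sub /(_ i); have := sub [set i] F; clear; lia.
Qed.

(** The rise from [F] to [G] is the gap condition for all points of the cone over [G :\: F], or
    flatness if there are none. Conversely, the Hall-Rado condition is a rise starting at the flag
    [set0]. *)
Lemma in_bergmanE rk C : polymatroid a rk -> set0 \in flags C ->
  in_bergman rk C = is_chain (flags C) && rises (excess rk (points C)) (flags C).
Proof.
move=> pm C0; have [rk0 mono _ _] := pm.
rewrite /in_bergman /is_cone -/(points C) -/(flags C) -/(is_chain (flags C)).
apply/and4P/andP => [[/andP[-> _] flatF _ gapF]|[-> /risesP r]].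
  split=> //; apply/risesP => F G FFs FG; rewrite excess_lt ?proper_sub//.
  rewrite /load; set T := _ :&: _; have [T0|T0] := eqVneq T set0.
    rewrite T0 cards0 addn0; have /properP[sFG [e eG eF]] := FG.
    have /forallP/(_ e) := forall_inP flatF _ FFs; rewrite eF /= => /leq_trans; apply.
    by apply: mono; rewrite subUset sub1set eG.
  have := forall_inP gapF _ FFs; move=> /forallP/(_ T); rewrite T0 /=.
  have -> : T \subset points C :\: Defs.preim F.
    by apply/subsetP => j; rewrite !inE => /andP[-> /andP[->]].
  move=> /= /leq_trans; apply; apply: mono; rewrite subUset proper_sub//=.
  by apply/subsetP => e /imsetP[j jT ->]; move: jT; rewrite !inE => /and3P[].
have rG F G : F \in flags C -> F \proper G ->
    (rk F + load (points C) (G :\: F) < rk G)%N.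
  by move=> FFs FG; rewrite -excess_lt ?proper_sub ?r.
have add F e : e \notin F -> F \proper e |: F.
  by move=> eF; apply: properUr; rewrite sub1set.
split=> /=.
(* If [i] in [A] were outside [F], the cone would have all [a i] points over [i], while adding [i]
   to [F] raises the rank by at most [a i]. *)
- apply/forallP => A; apply/implyP => AI; apply/forall_inP => F FFs.
  apply/subsetP => i iA; apply: contraT => iF.
  have := rG _ _ FFs (add _ _ iF); have := rk_setU1 F i pm.
  have : (a i <= load (points C) ((i |: F) :\: F))%N.
    rewrite -card_preim1; apply: subset_leq_card; apply/subsetP => j.
    rewrite !inE => /eqP ji; rewrite ji eqxx iF /= andbT.
    by have := subsetP AI j; rewrite !inE ji; apply.
  clear; lia.
- apply/forall_inP => F FFs; apply/forallP => e; apply/implyP => eF.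
  have := rG _ _ FFs (add _ _ eF); clear; lia.
- apply/forallP => T; apply/implyP => TI.
  have [->|T0] := eqVneq T set0; first by rewrite cards0.
  have [j jT] := set0Pn _ T0.
  have pT : set0 \proper pimg T.
    by rewrite proper0; apply/set0Pn; exists (pi_ j); apply: imset_f.
  have := rG _ _ C0 pT; rewrite rk0; have : (#|T| <= load (points C) (pimg T :\: set0))%N.
    apply: subset_leq_card; rewrite subsetI TI; apply/subsetP => j' j'T.
    by rewrite !inE; apply: imset_f.
  by move=> h /ltnW; apply: leq_trans h.
- apply/forall_inP => F FFs; apply/forallP => T; apply/implyP => /andP[T0 TI].
  have [j jT] := set0Pn _ T0.
  have pT : F \proper F :|: pimg T.
    apply/properUl/subsetPn; exists (pi_ j); first exact: imset_f.
    by have := subsetP TI _ jT; rewrite !inE => /andP[].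
  apply: leq_ltn_trans (rG _ _ FFs pT); rewrite leq_add2l; apply: subset_leq_card.
  apply/subsetP => j' j'T; have := subsetP TI _ j'T; rewrite !inE => /andP[-> ->] /=.
  by rewrite imset_f ?orbT.
Qed.

Lemma points_inl j C : points (inl j |: C) = j |: points C.
Proof. by apply/setP => j'; rewrite !inE. Qed.

Lemma points_inr (S0 : properset m) C : points (inr S0 |: C) = points C.
Proof. by apply/setP => j'; rewrite !inE. Qed.

Lemma flags_inl j C : flags (inl j |: C) = flags C.
Proof. by apply/setP => F; apply/imsetP/imsetP => -[S hS ->]; exists S => //; move: hS; rewrite !inE. Qed.

Lemma flags_inr (S0 : properset m) C : flags (inr S0 |: C) = val S0 |: flags C.
Proof.
rewrite -imsetU1; congr (imset _ (mem (pred_of_set _))).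
by apply/setP => S; rewrite !inE.
Qed.

Lemma mem_flags (S0 : properset m) C : (val S0 \in flags C) = (inr S0 \in C).
Proof. by rewrite mem_imset ?inE//; apply: val_inj. Qed.

Lemma card_cone C : #|C| = (#|points C| + #|flags C|)%N.
Proof.
rewrite card_imset; last exact: val_inj.
have inl_inj : injective (inl : Etil a -> Ray a) by move=> x y [].
have inr_inj : injective (inr : properset m -> Ray a) by move=> x y [].
rewrite -(card_imset _ inl_inj) -(card_imset _ inr_inj) -cardsUI.
have -> : (inl @: points C) :&: (inr @: [set S | inr S \in C]) = set0 :> {set Ray a}.
  by apply/setP => x; rewrite !inE; apply/negbTE/negP => /andP[/imsetP[? _ ->]/imsetP[]].
rewrite cards0 addn0; congr #|pred_of_set _|; apply/setP => -[x|x]; rewrite !inE mem_imset// inE.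
  by rewrite (_ : _ \in _ @: _ = false) ?orbF//; apply/negbTE/negP => /imsetP[].
by rewrite (_ : _ \in _ @: _ = false)//; apply/negbTE/negP => /imsetP[].
Qed.

(** The new point lowers the excess by one exactly on the sets containing [pi_ j], so only rises
    from a set missing [pi_ j] to one containing it are shortened. *)
Lemma rises_addpoint rk I Fs j : j \notin I ->
  rises (excess rk (j |: I)) Fs =
  rises (excess rk I) Fs && gaps (excess rk I) Fs [set pi_ j].
Proof.
move=> jI; have ej G : excess rk (j |: I) G = excess rk I G - (pi_ j \in G)%:Z.
  by rewrite /excess load_setU1//; clear; lia.
apply/risesP/andP => [r|[/risesP r /forall_inP g] F G FFs FG].
  split; first apply/risesP => F G FFs FG.
    have := r _ _ FFs FG; rewrite !ej; have := subsetP (proper_sub FG) (pi_ j).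
    by case: (_ \in F) => [->//|_]; clear; lia.
  apply/forall_inP => F FFs; rewrite sub1set; have [//|/= jF] := boolP (_ \in F).
  apply/farP => G FG; rewrite sub1set => jG.
  have pFG : F \proper G by apply/properP; split=> //; exists (pi_ j).
  have := r _ _ FFs pFG; rewrite !ej jG (negPf jF); clear; lia.
have := r _ _ FFs FG; have := g _ FFs; rewrite sub1set !ej.
have [jF _|jF /= /farP/(_ G (proper_sub FG))] := boolP (_ \in F).
  by rewrite (subsetP (proper_sub FG) _ jF); clear; lia.
rewrite sub1set; case: (_ \in G) => [/(_ isT)|_]; clear; lia.
Qed.

Lemma truncation_polymatroid rk S :
  polymatroid a rk -> (0 < rk S)%N -> polymatroid a (truncation rk S).
Proof.
case=> rk0 mono sub ub rkS; split.
- by rewrite /truncation rk0 min0n.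
- move=> A B AB; have := mono _ _ AB; have := mono _ _ (setSU S AB).
  rewrite /truncation; clear; lia.
- move=> A B; rewrite /truncation.
  have := sub A B; have := sub (A :|: S) B; have := sub A (B :|: S).
  have := sub (A :|: S) (B :|: S).
  have -> : (A :|: S) :|: B = (A :|: B) :|: S by rewrite setUAC.
  have -> : A :|: (B :|: S) = (A :|: B) :|: S by rewrite setUA.
  have -> : (A :|: S) :|: (B :|: S) = (A :|: B) :|: S.
    by rewrite setUACA setUid.
  have -> : (A :|: S) :&: (B :|: S) = (A :&: B) :|: S by rewrite setUIl.
  have := mono (A :&: B) ((A :|: S) :&: B) (setSI _ (subsetUl _ _)).
  have := mono (A :&: B) (A :&: (B :|: S)) (setIS _ (subsetUl _ _)).
  have := mono _ _ (subsetUl A S); have := mono _ _ (subsetUl B S).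
  have := mono _ _ (subsetUl (A :|: B) S); have := mono _ _ (subsetUl (A :&: B) S).
  have := mono _ _ (subsetUr (A :&: B) S); have := mono _ _ (subsetUr (A :|: B) S).
  have := mono _ _ (subsetUr A S); have := mono _ _ (subsetUr B S); move: rkS.
  clear; lia.
by move=> i; have := ub i; rewrite /truncation; clear; lia.
Qed.

(** By the diminishing returns in [diff], the sets lowered by truncation are closed under
    enlargement. A rise shortens only if the upper set is lowered and [F] is not, and the gap of two
    absorbs this loss. *)
Lemma rises_truncation rk S I Fs : polymatroid a rk -> (0 < rk S)%N ->
  rises (excess (truncation rk S) I) Fs =
  rises (excess rk I) Fs && gaps (excess rk I) Fs S.
Proof.
move=> [rk0 mono sub _] rkS.
have rkUS A : (rk A <= rk (A :|: S))%N /\ (0 < rk (A :|: S))%N.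
  by have := mono _ _ (subsetUl A S); have := mono _ _ (subsetUr A S); move: rkS; clear; lia.
have diff A B : A \subset B -> (rk (B :|: S) + rk A <= rk B + rk (A :|: S))%N.
  move=> AB; have := sub B (A :|: S); rewrite setUA (setUidPl AB).
  have : (rk A <= rk (B :&: (A :|: S)))%N by apply: mono; rewrite subsetI AB subsetUl.
  clear; lia.
apply/risesP/andP => [r|[/risesP r /forall_inP g] F G FFs FG].
  have rf : rises (excess rk I) Fs.
    apply/risesP => F G FFs FG; have := r _ _ FFs FG; have := diff _ _ (proper_sub FG).
    have [] := rkUS F; have [] := rkUS G; rewrite /excess /truncation; clear; lia.
  split=> //; apply/forall_inP => F FFs; have [//|/= SF] := boolP (S \subset F).
  apply/farP => G FG SG.
  have pFG : F \proper G by rewrite properE FG; apply: contra SF; apply: subset_trans.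
  have := r _ _ FFs pFG; move/risesP: rf => /(_ _ _ FFs (properUl SF)).
  rewrite /excess /truncation (setUidPl SG).
  have := loadS I (subsetUl F S).
  have [] := rkUS G; rewrite (setUidPl SG); clear; lia.
have := r _ _ FFs FG; have := diff _ _ (proper_sub FG); have [] := rkUS F; have [] := rkUS G.
rewrite /excess /truncation; have [SF|SF] := boolP (S \subset F).
  rewrite (setUidPl SF) (setUidPl (subset_trans SF (proper_sub FG))); clear; lia.
(* If [G] is lowered, [G :|: S] has the same rank and at least the same load, so the gap at
   [G :|: S] passes to [G]. *)
have := g _ FFs; rewrite (negPf SF) /= => /farP/(_ (G :|: S)).
rewrite subsetUr (subset_trans (proper_sub FG) (subsetUl _ _)) => /(_ isT isT).
rewrite /excess.
have := loadS I (subsetUl G S); clear; lia.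
Qed.

End Bergman.

(** * Degrees of monomials and multiplication by [hS] *)

Section Degree.
Variables (m : nat) (a : 'I_m -> nat).
Implicit Types (rk : {set 'I_m} -> nat) (A F G S X : {set 'I_m}) (C : {set Ray a}).
Implicit Types (q : cpoly a) (T z : properset m) (j : Etil a).

Local Notation xpoint j := (xray (inl j : Ray a)).
Local Notation xflag T := (xray (inr T : Ray a)).

Lemma xmonoU1 (rho : Ray a) C : rho \notin C -> xmono (rho |: C) = xray rho * xmono C.
Proof. by move=> rhoC; rewrite /xmono big_setU1. Qed.

Lemma xS_val T : xS a (val T) = xflag T.
Proof.
rewrite /xS (big_pred1 (inr T)) // => -[j|T0] //=.
Qed.

Lemma hS_sum S : hS a S = \sum_(T : properset m | ~~ (S \subset val T)) xflag T.
Proof.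
rewrite (partition_big val (fun F => (F != setT) && ~~ (S \subset F))) /=; last first.
  by move=> T ->; rewrite (valP T).
apply: eq_bigr => F /andP[_ SF]; rewrite /xS big_sumType /= big_pred0_eq add0r.
by apply: eq_bigl => T; case: eqP => [->|]; rewrite ?SF ?andbF.
Qed.

Lemma linrelE j :
  linrel j = xpoint j - \sum_(T : properset m | pi_ j \notin val T) xflag T.
Proof.
rewrite /linrel big_sumType /=; congr (_ + _).
  rewrite (bigD1 j)//= eqxx scale1r big1 ?addr0// => j' /negPf.
  by rewrite eq_sym => ->; rewrite scale0r.
rewrite [in RHS]big_mkcond -sumrN; apply: eq_bigr => T _; rewrite inE.
by case: (_ \in _); rewrite /= ?oppr0 ?scale0r// scaleNr scale1r.
Qed.

(** A set missing [pi_ j] cannot contain [S], so these sets contribute to [hS] exactly the flag sum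
    of [linrel j]. *)
Lemma hS_linrel S j : pi_ j \in S ->
  hS a S = xpoint j +
    \sum_(T : properset m | (pi_ j \in val T) && ~~ (S \subset val T)) xflag T - linrel j.
Proof.
move=> jS; rewrite linrelE opprB addrC addrA subrK addrC.
rewrite hS_sum (bigID (fun T : properset m => pi_ j \in val T)) /=; congr (_ + _).
  by apply: eq_bigl => T; rewrite andbC.
apply: eq_bigl => T; have [//|jT] := boolP (pi_ j \in val T); rewrite ?andbF// andbT.
by apply: contra jT => /subsetP; apply.
Qed.

Section Phi.
Variables (phi : cpoly a -> int) (deg_phi : chow_degree phi).

Lemma degree0 : phi 0 = 0.
Proof. by case: deg_phi => phiD _ _ _ _; have := phiD 0 0; rewrite addr0; lia. Qed.

Lemma degree_sum (I : finType) (P : pred I) (f : I -> cpoly a) :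
  phi (\sum_(i | P i) f i) = \sum_(i | P i) phi (f i).
Proof.
by apply: (big_morph phi); [case: deg_phi | exact: degree0].
Qed.

Lemma degree_cone q C S z : S != set0 -> is_cone C -> inr z \in C -> val z = set0 ->
  exists (F : {set 'I_m}) j,
    [/\ [/\ F \in flags C, ~~ (S \subset F) &
          forall G, G \in flags C -> F \proper G -> S \subset G],
        [/\ pi_ j \in S, pi_ j \notin F & inl j \notin C],
        (forall T, (pi_ j \in val T) && ~~ (S \subset val T) -> inr T \notin C) &
        phi (q * hS a S * xmono C) = phi (q * xmono (inl j |: C)) +
          \sum_(T : properset m | (pi_ j \in val T) && ~~ (S \subset val T))
            phi (q * xmono (inr T |: C))].
Proof.
move=> S0 coneC zC z0; have := coneC => /andP[cC /forallP hI].
have C0 : set0 \in flags C by rewrite -z0 mem_flags.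
have P0 : (set0 \in flags C) && ~~ (S \subset set0) by rewrite C0 subset0.
pose F := [arg max_(F > set0 | (F \in flags C) && ~~ (S \subset F)) #|F|].
have [{}F /andP[FC SF] Fmax] : extremum_spec geq
    [pred F | (F \in flags C) && ~~ (S \subset F)] (fun F : {set 'I_m} => #|F|) F.
  exact: arg_maxnP.
have {}Fmax G : G \in flags C -> F \proper G -> S \subset G.
  move=> GC FG; apply: contraT => SG; have := Fmax G; rewrite /= GC SG => /(_ isT).
  by rewrite /geq/= leqNgt proper_card.
have /subsetPn[i iS iF] := SF.
(* If the cone had all points over [i], its defining condition would put [i] in [F]. *)
have : ~~ (Defs.preim [set i] \subset points C).
  apply/negP => iC; have := hI [set i]; rewrite iC /= => /forall_inP/(_ _ FC).
  by rewrite sub1set (negPf iF).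
case/subsetPn => j; rewrite !inE => /eqP ji jC.
have notin T : (i \in val T) && ~~ (S \subset val T) -> inr T \notin C.
  case/andP=> iT ST; rewrite -mem_flags; apply/negP => TC.
  case/orP: (chainP cC TC FC) => [/subsetP/(_ _ iT)|]; first by rewrite (negPf iF).
  rewrite subEproper => /predU1P[FT|/(Fmax _ TC)]; last by rewrite (negPf ST).
  by rewrite FT iT in iF.
exists F, j; rewrite ji; split=> //.
case: deg_phi => phiD _ _ phi_lin _.
have phiB x y : phi (x - y * linrel j) = phi x.
  have := phiD x (- y * linrel j); rewrite phi_lin mulNr => ->; exact: addr0.
rewrite (@hS_linrel S j) ?ji// mulrBr mulrBl [X in _ - X]mulrAC phiB.
rewrite mulrDr mulrDl phiD mulr_sumr mulr_suml degree_sum xmonoU1// mulrA; congr (_ + _).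
by apply: eq_bigr => T hT; rewrite xmonoU1 ?mulrA// notin.
Qed.

(** If [q] pairs with the sets of rays through [z] as the Bergman class does, then for [0 < rk S]
    the product [q * hS a S] pairs with sets one ray smaller as the truncated fan does, by
    [rises_truncation]. *)
Lemma degree_step rk q S C z : polymatroid a rk -> S != set0 ->
    inr z \in C -> val z = set0 -> rk setT = #|C|.+1 ->
    (forall C, inr z \in C -> #|C| = rk setT -> phi (q * xmono C) = (in_bergman rk C : nat)) ->
  phi (q * hS a S * xmono C) =
    (in_bergman rk C && gaps (excess rk (points C)) (flags C) S : nat).
Proof.
move=> pm S0 zC z0 cardC hq.
have [coneC|ncone] := boolP (is_cone C); last first.
  by rewrite /in_bergman (negPf ncone)/=; case: deg_phi => _ _ -> //.
have C0 : set0 \in flags C by rewrite -z0 mem_flags.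
have [F [j [[FC SF Fmax] [jS jF jC] notin ->]]] := degree_cone q S0 coneC zC z0.
rewrite hq; [|by rewrite inE zC orbT|by rewrite cardsU1 jC cardC].
have in_flags j' : set0 \in flags (inl j' |: C) by rewrite flags_inl.
have in_flags' T : set0 \in flags (inr T |: C) by rewrite flags_inr inE C0 orbT.
rewrite !in_bergmanE// points_inl flags_inl rises_addpoint; last by rewrite inE.
rewrite [X in _ + X](_ : _ = \sum_(T : properset m | (pi_ j \in val T) && ~~ (S \subset val T))
    (is_chain (val T |: flags C) && rises (excess rk (points C)) (val T |: flags C) : nat)%:Z);
    last first.
  apply: eq_bigr => T hT; rewrite hq; [|by rewrite inE zC orbT|by rewrite cardsU1 notin// cardC].
  by rewrite in_bergmanE// points_inr flags_inr.
have [cC /=|ncC] := boolP (is_chain (flags C)); last first.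
  rewrite big1 ?addr0// => T _; rewrite (_ : is_chain _ = false)//.
  apply: contraNF ncC => /chainP cT; apply/forall_inP => A AC; apply/forall_inP => B BC.
  by apply: cT; rewrite inE ?AC ?BC orbT.
have [rC /=|nrC] := boolP (rises _ (flags C)); last first.
  rewrite big1 ?addr0// => T _; rewrite (_ : rises _ _ = false) ?andbF//.
  apply: contraNF nrC => /risesP rT; apply/risesP => A B AC; apply: rT.
  by rewrite inE AC orbT.
have sub_f := excess_submodular (points C) pm.
rewrite (gaps_far sub_f cC rC FC SF)//.
rewrite (@gaps_far _ _ _ F [set pi_ j] sub_f cC rC FC) ?sub1set//; last first.
  by move=> G GC FG; rewrite sub1set; apply: (subsetP (Fmax _ GC FG)).
have [rk0 _ _ _] := pm.
have FsT : setT \notin flags C.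
  by apply/imsetP => -[T _ e]; have := valP T; rewrite /= -e eqxx.
have dimC : excess rk (points C) setT = excess rk (points C) set0 + #|flags C|.+1%:Z.
  by rewrite /excess rk0 cardC card_cone load0 loadT; clear; lia.
rewrite (far_refine sub_f cC rC FC Fmax jS jF C0 FsT dimC) PoszD; congr (_ + _).
pose P (T : {set 'I_m}) := [&& pi_ j \in T, ~~ (S \subset T), is_chain (T |: flags C) &
  rises (excess rk (points C)) (T |: flags C)].
(* The count in [far_refine] is over arbitrary sets, the sum over proper ones; an insertable set is
   proper since it does not contain [S]. *)
rewrite -/P (_ : [set T | P T] = val @: [set T : properset m | P (val T)]); last first.
  apply/setP => T; rewrite inE; apply/idP/imsetP => [PT|[T' + ->]]; last by rewrite inE.
  have TT : T != setT by case/and3P: PT => _ ST _; apply: contraNneq ST => ->; apply: subsetT.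
  by exists (Sub T TT : properset m); rewrite ?inE SubK.
rewrite card_imset; last exact: val_inj.
rewrite cardsE -sum1_card (big_morph Posz PoszD (erefl 0%:Z)) big_mkcond [RHS]big_mkcond.
apply: eq_bigr => T _; rewrite [in RHS]/in_mem /= /P andbA.
by case: ifP => //= _; case: (is_chain _ && _).
Qed.

(** * The dragon Hall-Rado condition under successive truncations *)

Section Dragon.
Variables (k : nat) (S : 'I_k -> {set 'I_m}) (z : properset m).
Hypotheses (S0 : forall l, S l != set0) (z0 : val z = set0).
Implicit Types (J K : {set 'I_k}).

(** Vanishing of all pairings through [z] survives multiplication by any [hS]. This covers the case
    where a truncation would create a loop and the induction on polymatroids stops. *)
Lemma degree_hS_eq0 K q :
    (forall C, inr z \in C -> #|C| = #|K|.+1 -> phi (q * xmono C) = 0) ->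
  phi ((\prod_(l in K) hS a (S l)) * q * xS a set0) = 0.
Proof.
have [n] := ubnP #|K|; elim: n K q => // n IHn K q ltKn hq; have [K0|[l0 lK]] := set_0Vmem K.
  have := hq [set inr z]; rewrite inE eqxx K0 cards0 cards1 => /(_ isT erefl).
  by rewrite big_set0 mul1r -z0 xS_val /xmono big_set1.
rewrite (big_setD1 _ lK) /= (mulrC (hS _ _)) -(mulrA _ _ q) (mulrC _ q).
have cK : #|K| = #|K :\ l0|.+1 by rewrite (cardsD1 l0) lK.
apply: IHn; first by rewrite cK ltnS in ltKn.
move=> C zC cardC; have [coneC|ncone] := boolP (is_cone C); last first.
  by case: deg_phi => _ _ -> //.
have [F [j [_ [_ _ jC] notin ->]]] := degree_cone q (S0 l0) coneC zC z0.
rewrite hq ?add0r; last first.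
- by rewrite cardsU1 jC cardC cK.
- by rewrite inE zC orbT.
rewrite big1 // => T hT; apply: hq; first by rewrite inE zC orbT.
by rewrite cardsU1 notin // cardC cK.
Qed.

Definition dragon rk K :=
  [forall J : {set 'I_k}, (J \subset K) && (J != set0) ==> (#|J| < rk (\bigcup_(l in J) S l))%N].

Lemma dragonP rk K : reflect
  (forall J, J \subset K -> J != set0 -> (#|J| < rk (\bigcup_(l in J) S l))%N) (dragon rk K).
Proof.
apply: (iffP forallP) => [h J JK J0|h J]; first by have := h J; rewrite JK J0.
by apply/implyP => /andP[]; apply: h.
Qed.

(** For nonempty [J] without [l0], the two terms of the minimum in [truncation] give the dragon
    conditions for [J] and [l0 |: J]; only the singleton of [l0] is left over. *)
Lemma dragon_truncation rk K l0 : polymatroid a rk -> l0 \in K ->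
  dragon rk K = (1 < rk (S l0))%N && dragon (truncation rk (S l0)) (K :\ l0).
Proof.
move=> pm lK; have [_ mono _ _] := pm; apply/dragonP/andP => [h|[rkS /dragonP h] J JK J0].
  split.
    by have := h [set l0]; rewrite sub1set lK big_set1 cards1 -card_gt0 cards1 => /(_ isT isT).
  apply/dragonP => J; rewrite subsetD1 => /andP[JK lJ] J0.
  have := h _ JK J0; have := h (l0 |: J); rewrite subUset sub1set lK JK cardsU1 lJ.
  rewrite big_setU1//= (setUC (S l0)) /truncation => /(_ isT).
  have -> : l0 |: J != set0 by apply/set0Pn; exists l0; rewrite setU11.
  by move=> /(_ isT); clear; lia.
have [lJ|lJ] := boolP (l0 \in J); last first.
  have := h J; rewrite subsetD1 JK lJ /truncation => /(_ isT J0); clear; lia.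
rewrite (big_setD1 _ lJ) (cardsD1 l0) lJ /=.
have [->|J'0] := eqVneq (J :\ l0) set0; first by rewrite big_set0 setU0 cards0.
by have := h (J :\ l0) (setSD _ JK) J'0; rewrite /truncation (setUC (S l0)); rewrite leq_min ltn_predRL => /andP[_].
Qed.

(** Here [rk] and [q] vary together: each factor replaces [rk] by its truncation and [q] by its
    product with that [hS], which keeps the pairing hypothesis. *)
Lemma degree_dragon rk K q : polymatroid a rk -> loopless rk -> rk setT = #|K|.+1 ->
    (forall C, inr z \in C -> #|C| = rk setT -> phi (q * xmono C) = (in_bergman rk C : nat)) ->
  phi ((\prod_(l in K) hS a (S l)) * q * xS a set0) = (dragon rk K : nat).
Proof.
have [n] := ubnP #|K|; elim: n K rk q => // n IHn K rk q ltKn pm loop rkK hq; have [rk0 mono _ _] := pm.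
have [K0|[l0 lK]] := set_0Vmem K.
  (* In rank one the ray [z] alone is a cone of the fan, because looplessness makes the excess rise
     from [set0]. *)
  have C0 : set0 \in flags ([set inr z] : {set Ray a}) by rewrite -z0 mem_flags inE.
  have := hq [set inr z]; rewrite inE eqxx rkK K0 cards0 cards1 => /(_ isT erefl).
  rewrite big_set0 mul1r -z0 xS_val /xmono big_set1 => ->.
  have -> : dragon rk set0.
    by apply/dragonP => J; rewrite subset0 => ->.
  rewrite in_bergmanE//.
  have flagsE : flags ([set inr z] : {set Ray a}) = [set set0].
    by rewrite -[[set inr z]]setU0 flags_inr z0 /flags (_ : [set _ | _] = set0) ?imset0 ?setU0//;
      apply/setP => T; rewrite !inE.
  rewrite flagsE (_ : is_chain _ && _)//; apply/andP; split.
    by apply/forall_inP => A; rewrite inE => /eqP->; apply/forall_inP => B; rewrite sub0set.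
  apply/risesP => F G; rewrite inE => /eqP -> G0; rewrite excess_lt ?sub0set// rk0.
  rewrite /load (_ : points _ :&: _ = set0); last by apply/setP => j; rewrite !inE.
  rewrite cards0; move: G0; rewrite proper0 => /set0Pn[i iG].
  by apply: leq_trans (loop i) _; apply: mono; rewrite sub1set.
have cK : #|K| = #|K :\ l0|.+1 by rewrite (cardsD1 l0) lK.
rewrite (big_setD1 _ lK) /= (mulrC (hS _ _)) -(mulrA _ _ q) (mulrC _ q).
have step C : inr z \in C -> #|C| = #|K| -> phi (q * hS a (S l0) * xmono C) =
    (in_bergman rk C && gaps (excess rk (points C)) (flags C) (S l0) : nat).
  by move=> zC cC; apply: degree_step zC z0 _ hq => //; rewrite cC.
rewrite (dragon_truncation pm lK); have [rkS|rkS] /= := ltnP 1 (rk (S l0)); last first.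
  (* The flag [set0] has no gap towards [S l0], of rank at most one, so every pairing is 0. *)
  apply: degree_hS_eq0 => C zC; rewrite -cK => cC; rewrite step//.
  rewrite (_ : gaps _ _ _ = false) ?andbF//; apply/negbTE/negP => /forall_inP/(_ set0).
  rewrite -z0 mem_flags z0 => /(_ zC); rewrite subset0 (negPf (S0 l0)) /=.
  move=> /farP/(_ (S l0)); rewrite sub0set subxx /excess rk0 load0 => /(_ isT isT).
  by move: rkS; clear; lia.
have rkS0 : (0 < rk (S l0))%N by apply: ltn_trans rkS.
have tT : truncation rk (S l0) setT = #|K|.
  by rewrite /truncation setTU rkK; clear; lia.
apply: IHn.
- by rewrite cK ltnS in ltKn.
- exact: truncation_polymatroid.
(* No loop appears: [rk ([set i] :|: S l0)] is at least [rk (S l0)], hence at least 2. *)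
- move=> i; rewrite /truncation leq_min loop ltn_predRL.
  exact: leq_trans rkS (mono _ _ (subsetUr _ _)).
- by rewrite tT cK.
move=> C zC; rewrite tT => cC; rewrite step//.
have C0 : set0 \in flags C by rewrite -z0 mem_flags.
rewrite !in_bergmanE ?rises_truncation ?andbA//.
exact: truncation_polymatroid.
Qed.

End Dragon.
End Phi.
End Degree.

Theorem theorem6p4 (m : nat) (a : 'I_m -> nat) (rk : {set 'I_m} -> nat)
    (hP : polymatroid a rk) (hloop : loopless rk) (hr : (0 < rk setT)%N)
    (S : 'I_(rk setT).-1 -> {set 'I_m}) (hS0 : forall j, S j != set0)
    (phi : cpoly a -> int) (hphi : chow_degree phi)
    (p : cpoly a) (hp : bergman_class rk phi p) :
  phi ((\prod_(j < (rk setT).-1) hS a (S j)) * p * xS a set0)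
  = (if dragon_hall_rado rk S then 1 else 0).
Proof.
have [rk0 _ _ _] := hP; case: hp => _ hp.
have nT0 : set0 != setT :> {set 'I_m} by apply: contraTneq hr => <-; rewrite rk0.
(* Sets of rays that are not cones give 0 on both sides, so the defining pairings extend to them. *)
have hB (C : {set Ray a}) : #|C| = rk setT -> phi (p * xmono C) = (in_bergman rk C : nat).
  have [coneC|ncone _] := boolP (is_cone C); first exact: hp.
  by rewrite /in_bergman (negPf ncone); case: hphi => _ _ ->.
have cT : rk setT = #|[set: 'I_(rk setT).-1]|.+1 by rewrite cardsT card_ord prednK.
have := degree_dragon hphi (z := Sub set0 nT0) hS0 (SubK _ _) hP hloop cT (fun C _ => hB C).
rewrite (eq_bigl xpredT) => [->|j]; last exact: in_setT.
have -> : dragon_hall_rado rk S = dragon S rk setT.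
  by apply: eq_forallb => J; rewrite subsetT addn1.
by case: (dragon _ _ _).
Qed.
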